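(* Let $(D,\vdash,\dashv,\circ)$ be a di-skew brace. For $a\in D$ let $\lambda_a:D\to D$, $\lambda_a(b)=a^{-1}\vdash (a\circ b)$, and define $r:D\times D\to D\times D$ by $$r(a,b)=\left(\lambda_a(b),\ (\lambda_a(b))^-\circ\left(a\dashv\lambda_a(b)\right)\right)$$ for all $a,b\in D$. Then $(D,r)$ is a bijective non-degenerate solution of the set-theoretic Yang--Baxter equation. In particular, the left derived shelf associated with $r$ is the conjugation rack $\mathrm{Conj}(D,\vdash,\dashv)$, i.e. the set $D$ with the operation $a\triangleright b=a^{-1}\vdash b\dashv a$.
   Context: A disemigroup is a set $D$ with two associative binary operations $\vdash,\dashv$ such that $a\vdash(b\dashv c)=(a\vdash b)\dashv c$, $a\dashv(b\vdash c)=a\dashv(b\dashv c)$ and $(a\vdash b)\vdash c=(a\dashv b)\vdash c$ for all $a,b,c$. A bar-unit is an element $e\in D$ with $e\vdash a=a=a\dashv e$ for all $a\in D$; $E(D)$ denotes the set of bar-units. A generalized digroup ($g$-digroup) is a disemigroup with at least one bar-unit such that for every $a\in D$ and every bar-unit $e$ there is a unique pair of elements $a^{I_e},a^{J_e}\in D$ with $a^{I_e}\dashv a=e=a\vdash a^{J_e}$. In a $g$-digroup the elements $a^{I_e}\vdash b=a^{J_{e'}}\vdash b$ and $b\dashv a^{I_e}=b\dashv a^{J_{e'}}$ do not depend on the bar-units $e,e'$; they are written $a^{-1}\vdash b$ and $b\dashv a^{-1}$. A right group is a semigroup $(D,\circ)$ such that for all $a,b\in D$ there is a unique $x\in D$ with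 $a\circ x=b$; this $x$ is written $a^-\circ b$. A di-skew brace is a quadruple $(D,\vdash,\dashv,\circ)$ where $(D,\vdash,\dashv)$ is a $g$-digroup, $(D,\circ)$ is a right group, and for all $a,b,c\in D$ (with $\circ$ having higher precedence than $\vdash,\dashv$): $a\circ(b\vdash c)=a\circ b\vdash a^{-1}\vdash a\circ c$, $\ a\circ(b\dashv c)=a\circ b\dashv a^{-1}\dashv a\circ c$, and $(a\vdash b)\circ c=(a\dashv b)\circ c$. A solution on a set $D$ is a map $r:D\times D\to D\times D$ with $(r\times\mathrm{id})(\mathrm{id}\times r)(r\times\mathrm{id})=(\mathrm{id}\times r)(r\times\mathrm{id})(\mathrm{id}\times r)$. Writing $r(a,b)=(\lambda_a(b),\rho_b(a))$, it is left non-degenerate if all $\lambda_a$ are bijective, right non-degenerate if all $\rho_b$ are bijective, non-degenerate if both; it is bijective if $r$ is a bijection. The left derived shelf of a left non-degenerate solution $r$ is $(D,\triangleright_r)$ with $a\triangleright_r b=\lambda_a\rho_{\lambda_b^{-1}(a)}(b)$. *)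

(* Defs.v *)
From HB Require Import structures.
From mathcomp Require Import all_boot.
From mathcomp Require Import boolp.

Set Implicit Arguments.
Unset Strict Implicit.
Unset Printing Implicit Defensive.

Declare Scope dsb_scope.
Delimit Scope dsb_scope with dsb.
Local Open Scope dsb_scope.

Reserved Notation "a ⊢ b" (at level 50, left associativity).
Reserved Notation "a ⊣ b" (at level 50, left associativity).
Reserved Notation "a ∘ b" (at level 40, left associativity).

HB.mixin Record isDisemigroup D := {
  vdash : D -> D -> D;
  dashv : D -> D -> D;
  vdashA : forall a b c, vdash a (vdash b c) = vdash (vdash a b) c;
  dashvA : forall a b c, dashv a (dashv b c) = dashv (dashv a b) c;
  vdash_dashvA : forall a b c, vdash a (dashv b c) = dashv (vdash a b) c;
  dashv_vdash : forall a b c, dashv a (vdash b c) = dashv a (dashv b c);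
  vdash_dashv : forall a b c, vdash (vdash a b) c = vdash (dashv a b) c;
}.

#[short(type="disemigroupType")]
HB.structure Definition Disemigroup := { D of isDisemigroup D }.

Notation "a ⊢ b" := (vdash a b) : dsb_scope.
Notation "a ⊣ b" := (dashv a b) : dsb_scope.

Definition bar_unit (D : disemigroupType) (e : D) : Prop :=
  forall a : D, e ⊢ a = a /\ a ⊣ e = a.

HB.mixin Record isGDigroup D of Disemigroup D := {
  ex_bar_unit : exists e : D, bar_unit e;
  ex_bar_inverses : forall (a e : D), bar_unit e ->
    exists! p : D * D, p.1 ⊣ a = e /\ e = a ⊢ p.2;
}.

#[short(type="gDigroupType")]
HB.structure Definition GDigroup := { D of Disemigroup D & isGDigroup D }.

Section GDigroupTheory.
Variable D : gDigroupType.
Implicit Types a b e f : D.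

Definition linv e (he : bar_unit e) a : D :=
  (projT1 (cid (ex_bar_inverses a e he))).1.

Definition rinv e (he : bar_unit e) a : D :=
  (projT1 (cid (ex_bar_inverses a e he))).2.

Lemma linvP e (he : bar_unit e) a : linv he a ⊣ a = e.
Proof. by rewrite /linv; case: cid => p [[]]. Qed.

Lemma rinvP e (he : bar_unit e) a : a ⊢ rinv he a = e.
Proof. by rewrite /rinv; case: cid => p [[]]. Qed.

(* The bar-unit chosen here is irrelevant: see [inv_vdashE], [dashv_invE]. *)
Definition some_bar_unit : {e : D | bar_unit e} := cid ex_bar_unit.

(* [inv_vdash a b] is a^{-1} ⊢ b and [dashv_inv b a] is b ⊣ a^{-1}. *)
Definition inv_vdash a b : D := linv (projT2 some_bar_unit) a ⊢ b.
Definition dashv_inv b a : D := b ⊣ linv (projT2 some_bar_unit) a.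

Lemma linv_rinv_vdash e f (he : bar_unit e) (hf : bar_unit f) a b :
  linv he a ⊢ b = rinv hf a ⊢ b.
Proof.
transitivity (e ⊢ (rinv hf a ⊢ b)); last by rewrite (he _).1.
have {2}<- := linvP he a; rewrite -vdash_dashv -vdashA.
by rewrite (vdashA a) rinvP (hf b).1.
Qed.

Lemma linv_rinv_dashv e f (he : bar_unit e) (hf : bar_unit f) a b :
  b ⊣ linv he a = b ⊣ rinv hf a.
Proof.
transitivity ((b ⊣ linv he a) ⊣ f); first by rewrite (hf _).2.
have {1}<- := rinvP hf a; rewrite dashv_vdash dashvA.
by rewrite -(dashvA b) linvP (he b).2.
Qed.

Lemma inv_vdashE e f (he : bar_unit e) (hf : bar_unit f) a b :
  inv_vdash a b = linv he a ⊢ b /\ inv_vdash a b = rinv hf a ⊢ b.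
Proof.
by rewrite /inv_vdash (linv_rinv_vdash _ hf) (linv_rinv_vdash he hf).
Qed.

Lemma dashv_invE e f (he : bar_unit e) (hf : bar_unit f) a b :
  dashv_inv b a = b ⊣ linv he a /\ dashv_inv b a = b ⊣ rinv hf a.
Proof.
by rewrite /dashv_inv (linv_rinv_dashv _ hf) (linv_rinv_dashv he hf).
Qed.

Definition conj_op a b : D := inv_vdash a b ⊣ a.

End GDigroupTheory.

HB.mixin Record isRightGroup D := {
  circ : D -> D -> D;
  circA : forall a b c, circ a (circ b c) = circ (circ a b) c;
  ex_circ_ldiv : forall a b, exists! x, circ a x = b;
}.

#[short(type="rightGroupType")]
HB.structure Definition RightGroup := { D of isRightGroup D }.

Notation "a ∘ b" := (circ a b) : dsb_scope.

(* [circ_ldiv a b] is a^- ∘ b. *)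
Definition circ_ldiv (D : rightGroupType) (a b : D) : D :=
  projT1 (cid (ex_circ_ldiv a b)).

Lemma circ_ldivP (D : rightGroupType) (a b : D) : a ∘ circ_ldiv a b = b.
Proof. by rewrite /circ_ldiv; case: cid => x []. Qed.

HB.mixin Record isDiSkewBrace D of GDigroup D & RightGroup D := {
  circ_vdash : forall a b c : D,
    a ∘ (b ⊢ c) = (a ∘ b) ⊢ inv_vdash a (a ∘ c);
  circ_dashv : forall a b c : D,
    a ∘ (b ⊣ c) = dashv_inv (a ∘ b) a ⊣ (a ∘ c);
  vdash_circ : forall a b c : D, (a ⊢ b) ∘ c = (a ⊣ b) ∘ c;
}.

#[short(type="diSkewBraceType")]
HB.structure Definition DiSkewBrace :=
  { D of GDigroup D & RightGroup D & isDiSkewBrace D }.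

Section Solutions.
Variable D : Type.
Implicit Type r : D * D -> D * D.

Definition map12 r (t : D * D * D) : D * D * D :=
  let: (x, y, z) := t in (r (x, y), z).

Definition map23 r (t : D * D * D) : D * D * D :=
  let: (x, y, z) := t in (x, (r (y, z)).1, (r (y, z)).2).

Definition solution r : Prop :=
  forall t, map12 r (map23 r (map12 r t)) = map23 r (map12 r (map23 r t)).

Definition lam r (a b : D) : D := (r (a, b)).1.
Definition rho r (b a : D) : D := (r (a, b)).2.

Definition left_nondegenerate r : Prop := forall a, bijective (lam r a).
Definition right_nondegenerate r : Prop := forall b, bijective (rho r b).
Definition nondegenerate r : Prop :=
  left_nondegenerate r /\ right_nondegenerate r.

Lemma lam_surj r (hr : left_nondegenerate r) a b : exists x, lam r a x = b.
Proof. by case: (hr a) => g _ gK; exists (g b). Qed.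

Definition lam_inv r (hr : left_nondegenerate r) (a b : D) : D :=
  projT1 (cid (lam_surj hr a b)).

Lemma lam_invK r (hr : left_nondegenerate r) a :
  cancel (lam_inv hr a) (lam r a).
Proof. by move=> b; rewrite /lam_inv; case: cid. Qed.

Lemma lamK r (hr : left_nondegenerate r) a :
  cancel (lam r a) (lam_inv hr a).
Proof. by move=> b; apply: (bij_inj (hr a)); rewrite lam_invK. Qed.

Definition left_derived_shelf r (hr : left_nondegenerate r) (a b : D) : D :=
  lam r a (rho r (lam_inv hr b a) b).

End Solutions.

Section DiSkewBraceSolution.
Variable D : diSkewBraceType.

Definition brace_lam (a b : D) : D := inv_vdash a (a ∘ b).

Definition brace_sol (p : D * D) : D * D :=
  let: (a, b) := p in
  (brace_lam a b, circ_ldiv (brace_lam a b) (a ⊣ brace_lam a b)).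

End DiSkewBraceSolution.

(* Main.v *)
Require Import Defs.
From mathcomp Require Import all_boot.
From mathcomp Require Import boolp.

(** Write $L_a$ for $b \mapsto a ⊢ b$ and $a ▷ b = a^{-1} ⊢ b ⊣ a$ for the
    conjugation.  Inverses are avoided by working with the
    equations $a ⊢ λ_a(b) = a ∘ b$ and $a ⊢ (a ▷ b) = b ⊣ a$, which
    determine $λ_a(b)$ and $a ▷ b$ because $L_a$ is injective.

    The compatibility axioms say that each $λ_a$ preserves $⊢$ and $⊣$, hence
    $▷$ ([brace_lam_conj]), and that $λ_{a ∘ b} = λ_a λ_b$.  If $r(a,b) = (u,v)$
    then $u ∘ v = a ⊣ u$ and $a ∘ b = a ⊢ u$; comparing the two yields
      $λ_u λ_v = λ_a λ_b$ ([brace_lam_rho_comp]) and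
      $λ_u(v) = u ▷ a$ ([brace_lam_rho]).
    So $r$ is the twist, by the automorphisms $λ_a$, of the derived solution
    $(a, b) \mapsto (b, b ▷ a)$ of the rack $(D, ▷)$.  The Yang-Baxter equation
    becomes self-distributivity of $▷$ ([conj_opD]), bijectivity of $r$ becomes
    bijectivity of $a ▷ -$, and the second identity is already the description
    of the left derived shelf.

    Right non-degeneracy is where the right group must be compared with the
    $g$-digroup.  The point is that $a ∘ -$ and $L_a$ determine each other
    ([circ_eq_of_vdash_eq], [vdash_eq_of_circ_eq]): $D$ lies over a skew brace
    whose elements are the common fibres of $a \mapsto L_a$ and
    $a \mapsto a ∘ -$.  In that quotient, if $a'$ is a $∘$-inverse of $a$ then
    $a' ∘ u = a' ⊢ b$, so $b = (a' ⊢ b) ∘ v$ and $b$, $v$ determine $a'$, hence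
    the class of $a$.  The class of $a$ determines $u = λ_a(b)$, and then
    $u ▷ a = λ_u(v)$ determines $a$ itself. *)

Set Implicit Arguments.
Unset Strict Implicit.
Unset Printing Implicit Defensive.

Local Open Scope dsb_scope.

Lemma inj_surj_bijective (A B : Type) (f : A -> B) :
  injective f -> (forall y, exists x, f x = y) -> bijective f.
Proof.
move=> f_inj f_surj; pose g y := projT1 (cid (f_surj y)).
have gK : cancel g f by move=> y; rewrite /g; case: cid.
by exists g => // x; apply: f_inj; rewrite gK.
Qed.

(** * Translations and conjugation in a g-digroup *)

Section Digroup.
Variable D : gDigroupType.
Implicit Types a b c e x y z : D.

Lemma vdashK a : cancel (vdash a) (inv_vdash a).
Proof.
move=> b; rewrite /inv_vdash vdashA vdash_dashv linvP.
exact: (projT2 (some_bar_unit D) b).1.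
Qed.

Lemma inv_vdashK a : cancel (inv_vdash a) (vdash a).
Proof.
move=> b; have he := projT2 (some_bar_unit D).
rewrite (inv_vdashE he he a b).2 vdashA rinvP; exact: (he b).1.
Qed.

Lemma vdash_inj a : injective (vdash a).
Proof. exact: can_inj (vdashK a). Qed.

Lemma dashvK a : cancel (dashv ^~ a) (fun b => dashv_inv b a).
Proof.
move=> b; have he := projT2 (some_bar_unit D).
rewrite /= (dashv_invE he he a _).2 -dashvA -dashv_vdash rinvP.
exact: (he b).2.
Qed.

Lemma dashv_invK a : cancel (fun b => dashv_inv b a) (dashv ^~ a).
Proof.
move=> b; rewrite /= /dashv_inv -dashvA linvP.
exact: (projT2 (some_bar_unit D) b).2.
Qed.

Lemma dashv_inj a : injective (dashv ^~ a).
Proof. exact: can_inj (dashvK a). Qed.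

Lemma vdash_conj a b : a ⊢ conj_op a b = b ⊣ a.
Proof. by rewrite /conj_op vdash_dashvA inv_vdashK. Qed.

Lemma conj_op_inj a : injective (conj_op a).
Proof.
move=> b c /(congr1 (vdash a)); rewrite !vdash_conj; exact: dashv_inj.
Qed.

Lemma conj_op_surj a c : exists b, conj_op a b = c.
Proof.
exists (dashv_inv (a ⊢ c) a); apply: (vdash_inj (a := a)).
by rewrite vdash_conj dashv_invK.
Qed.

(** Self-distributivity: after multiplying by [x ⊢ ((x ▷ y) ⊢ -)], both
    sides become [z ⊣ (y ⊣ x)]. *)
Lemma conj_opD x y z :
  conj_op x (conj_op y z) = conj_op (conj_op x y) (conj_op x z).
Proof.
apply: (vdash_inj (a := conj_op x y)); apply: (vdash_inj (a := x)).
transitivity (z ⊣ (y ⊣ x)); last first.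
  rewrite (vdash_conj (conj_op x y)) vdash_dashvA (vdash_conj x z).
  by rewrite -dashvA -(dashv_vdash z x) vdash_conj.
rewrite vdashA (vdash_conj x y) -vdash_dashv -vdashA vdash_conj.
by rewrite vdash_dashvA vdash_conj -dashvA.
Qed.

End Digroup.

(** * The maps [brace_lam a] *)

Section Brace.
Variable D : diSkewBraceType.
Implicit Types a b c e u v w x y z : D.

Lemma circ_inj a : injective (circ a).
Proof.
move=> b c bc; case: (ex_circ_ldiv a (a ∘ c)) => x [_ x_uniq].
by rewrite -(x_uniq b bc); apply: x_uniq.
Qed.

Lemma vdash_lam a b : a ⊢ brace_lam a b = a ∘ b.
Proof. exact: inv_vdashK. Qed.

Lemma brace_lam_inj a : injective (brace_lam a).
Proof.
by move=> b c /(congr1 (vdash a)); rewrite !vdash_lam; apply: circ_inj.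
Qed.

Lemma brace_lam_surj a c : exists b, brace_lam a b = c.
Proof.
exists (circ_ldiv a (a ⊢ c)); apply: (vdash_inj (a := a)).
by rewrite vdash_lam circ_ldivP.
Qed.

Lemma brace_lam_vdash a b c :
  brace_lam a (b ⊢ c) = brace_lam a b ⊢ brace_lam a c.
Proof.
by apply: (vdash_inj (a := a)); rewrite [RHS]vdashA !vdash_lam circ_vdash.
Qed.

Lemma brace_lam_dashv a b c :
  brace_lam a (b ⊣ c) = brace_lam a b ⊣ brace_lam a c.
Proof.
apply: (vdash_inj (a := a)); rewrite [RHS]vdash_dashvA !vdash_lam circ_dashv.
by rewrite -(vdash_lam a c) dashv_vdash dashvA dashv_invK.
Qed.

Lemma brace_lam_conj a b c :
  brace_lam a (conj_op b c) = conj_op (brace_lam a b) (brace_lam a c).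
Proof.
apply: (vdash_inj (a := brace_lam a b)).
by rewrite -brace_lam_vdash !vdash_conj brace_lam_dashv.
Qed.

Lemma brace_lam_circ a b c :
  brace_lam (a ∘ b) c = brace_lam a (brace_lam b c).
Proof.
apply: (vdash_inj (a := a ∘ b)).
by rewrite vdash_lam -circA -(vdash_lam b c) circ_vdash.
Qed.

Lemma brace_lam_vdash_dashv a b c :
  brace_lam (a ⊢ b) c = brace_lam (a ⊣ b) c.
Proof.
apply: (vdash_inj (a := a ⊢ b)).
by rewrite vdash_lam vdash_dashv vdash_lam vdash_circ.
Qed.

(** * The Yang-Baxter equation *)

Definition brace_rho a b : D :=
  circ_ldiv (brace_lam a b) (a ⊣ brace_lam a b).

Lemma brace_solE a b : brace_sol (a, b) = (brace_lam a b, brace_rho a b).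
Proof. by []. Qed.

Lemma circ_lam_rho a b :
  brace_lam a b ∘ brace_rho a b = a ⊣ brace_lam a b.
Proof. exact: circ_ldivP. Qed.

Lemma brace_lam_rho a b :
  brace_lam (brace_lam a b) (brace_rho a b) = conj_op (brace_lam a b) a.
Proof.
apply: (vdash_inj (a := brace_lam a b)).
by rewrite vdash_lam vdash_conj circ_lam_rho.
Qed.

Lemma brace_lam_rho_comp a b c :
  brace_lam (brace_lam a b) (brace_lam (brace_rho a b) c) =
  brace_lam a (brace_lam b c).
Proof.
by rewrite -!brace_lam_circ circ_lam_rho -brace_lam_vdash_dashv vdash_lam.
Qed.

(** Given the two identities for $λ_u$ above, an entry of the output is
    compared after applying the injective maps $λ$ indexed by the entries to
    its left; only the third entry uses self-distributivity. *)
Lemma brace_sol_solution : solution (@brace_sol D).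
Proof.
case=> [[x y] z]; rewrite /map12 /map23 !brace_solE /=.
set u := brace_lam x y; set v := brace_rho x y.
set p := brace_lam v z; set q := brace_rho v z.
set f := brace_lam y z; set g := brace_rho y z.
set h := brace_lam x f; set k := brace_rho x f.
have up : brace_lam u p = h by apply: brace_lam_rho_comp.
have kg : brace_lam h (brace_lam k g) = conj_op h u.
  by rewrite brace_lam_rho_comp brace_lam_rho brace_lam_conj.
have rho_up : brace_rho u p = brace_lam k g.
  by apply: (brace_lam_inj (a := h)); rewrite kg -up brace_lam_rho.
rewrite up rho_up; congr (_, _, _).
apply: (brace_lam_inj (a := brace_lam k g)).
apply: (brace_lam_inj (a := h)).
rewrite brace_lam_rho brace_lam_conj kg brace_lam_rho -/h -conj_opD.
rewrite -rho_up -up brace_lam_rho_comp brace_lam_rho brace_lam_conj.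
by rewrite brace_lam_rho.
Qed.

Lemma brace_sol_bijective : bijective (@brace_sol D).
Proof.
apply: inj_surj_bijective => [[a b] [a' b']|[u v]].
  rewrite !brace_solE => -[eq_u eq_v].
  have aa' : a = a'.
    apply: (@conj_op_inj _ (brace_lam a b)).
    by rewrite -brace_lam_rho eq_v eq_u brace_lam_rho.
  by move: eq_u; rewrite aa' => /brace_lam_inj ->.
have [a ua] := conj_op_surj u (brace_lam u v).
have [b ab] := brace_lam_surj a u.
exists (a, b); rewrite brace_solE ab; congr (_, _).
by apply: (brace_lam_inj (a := u)); rewrite -ua -ab brace_lam_rho.
Qed.

(** * Comparison of the translations [circ a] and [vdash a] *)

(** For a bar-unit [e], [a ⊢ e] acts through [circ] as [a ⊣ e = a]. *)
Lemma circ_eq_of_vdash_eq a b : vdash a =1 vdash b -> circ a =1 circ b.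
Proof.
have [e he] := @ex_bar_unit D; move=> ab c.
by rewrite -(he a).2 -(he b).2 -!vdash_circ ab.
Qed.

(** For a bar-unit [e], [a ∘ (e ⊢ c) = a ∘ c] says that [a ∘ e] and [a] have the
    same left translation on the image of [brace_lam a], which is everything. *)
Lemma vdash_eq_of_circ_eq a b : circ a =1 circ b -> vdash a =1 vdash b.
Proof.
have [e he] := @ex_bar_unit D; move=> ab.
have circ_unit x : vdash (x ∘ e) =1 vdash x.
  move=> c; have [d <-] := brace_lam_surj x c.
  by rewrite vdash_lam -circ_vdash (he d).1.
by move=> c; rewrite -circ_unit ab circ_unit.
Qed.

Lemma brace_lam_eq a b : circ a =1 circ b -> brace_lam a =1 brace_lam b.
Proof.
move=> ab c; apply: (vdash_inj (a := a)).
by rewrite vdash_lam ab (vdash_eq_of_circ_eq ab) vdash_lam.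
Qed.

(** The right unit [i] of [e] acts trivially for [circ]; then [brace_lam i] is
    injective and idempotent, hence the identity, so that [i] acts trivially for
    [vdash] too.  As [e] has the same trivial left translation, the comparison
    of translations carries [circ i] over to [circ e]. *)
Lemma bar_unit_circ e : bar_unit e -> forall c, e ∘ c = c.
Proof.
move=> he; pose i := circ_ldiv e e.
have ic c : i ∘ c = c by apply: (circ_inj (a := e)); rewrite circA circ_ldivP.
have lam_ic c : brace_lam i c = c.
  by apply: (brace_lam_inj (a := i)); rewrite -brace_lam_circ ic.
have i_e : vdash i =1 vdash e.
  by move=> c; rewrite -{1}(lam_ic c) vdash_lam ic (he c).1.
by move=> c; rewrite -(circ_eq_of_vdash_eq i_e) ic.
Qed.

Lemma exists_circ_inv a : exists a', cancel (circ a) (circ a') /\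
                                     cancel (circ a') (circ a).
Proof.
have [e he] := @ex_bar_unit D; exists (circ_ldiv a e).
have inv_r : cancel (circ (circ_ldiv a e)) (circ a).
  by move=> c; rewrite circA circ_ldivP bar_unit_circ.
by split=> // c; apply: (circ_inj (a := a)); rewrite inv_r.
Qed.

(** * Right non-degeneracy *)

(** [brace_lam a'] inverts [brace_lam a], since [a' ∘ a] acts as a bar-unit. *)
Lemma circ_inv_lam a a' b :
  cancel (circ a) (circ a') -> a' ∘ brace_lam a b = a' ⊢ b.
Proof.
move=> aK; have [e he] := @ex_bar_unit D.
have lam_e c : brace_lam e c = c.
  by apply: (vdash_inj (a := e)); rewrite vdash_lam bar_unit_circ // (he c).1.
rewrite -vdash_lam -brace_lam_circ (@brace_lam_eq (a' ∘ a) e) ?lam_e //.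
by move=> c; rewrite -circA aK bar_unit_circ.
Qed.

(** The quotient form of $v^- = b^- ∘ (a^- ⊢ b)$, the skew brace formula for
    $v = ρ_b(a)$: it recovers $a^-$ from $b$ and $v$. *)
Lemma circ_inv_vdash_rho a a' b :
  cancel (circ a) (circ a') -> circ ((a' ⊢ b) ∘ brace_rho a b) =1 circ b.
Proof.
move=> aK c; rewrite -(circ_inv_lam b aK) -(circA a') circ_lam_rho -circA.
by rewrite -vdash_circ vdash_lam -circA aK.
Qed.

Lemma brace_rho_inj b : injective (brace_rho ^~ b).
Proof.
move=> a1 a2 /= eq_rho.
have [a1' [a1K a1'K]] := exists_circ_inv a1.
have [a2' [a2K a2'K]] := exists_circ_inv a2.
have eq_b : circ (a1' ⊢ b) =1 circ (a2' ⊢ b).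
  have [v' [_ v'K]] := exists_circ_inv (brace_rho a1 b).
  move=> c; rewrite -(v'K c) !circA (circ_inv_vdash_rho b a1K) eq_rho.
  by rewrite (circ_inv_vdash_rho b a2K).
have eq_inv : circ a1' =1 circ a2'.
  apply: circ_eq_of_vdash_eq => c.
  rewrite -(inv_vdashK b c); move: (inv_vdash b c) => d; rewrite !vdashA.
  exact: vdash_eq_of_circ_eq.
have eq_a : circ a1 =1 circ a2.
  by move=> c; apply: (circ_inj (a := a1')); rewrite a1K eq_inv a2K.
have eq_u := brace_lam_eq eq_a b.
apply: (@conj_op_inj _ (brace_lam a1 b)).
by rewrite -brace_lam_rho eq_rho eq_u brace_lam_rho.
Qed.

Lemma brace_rho_surj b v : exists a, brace_rho a b = v.
Proof.
have [v' [vK v'K]] := exists_circ_inv v.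
(* In the quotient, $b = (w ⊢ b) ∘ v$: so [w] is the inverse of the sought
   element, and its inverse [a0] is a first approximation of it. *)
pose w := dashv_inv (b ∘ v') b; have [a0 [wK a0K]] := exists_circ_inv w.
have wb : circ (w ⊢ b) =1 circ (b ∘ v').
  by move=> c; rewrite vdash_circ [w ⊣ b]dashv_invK.
pose u := brace_lam a0 b.
have [a ua] := conj_op_surj u (brace_lam u v).
have au : a ⊣ u = u ∘ v by rewrite -vdash_conj ua vdash_lam.
have a_a0 : circ a =1 circ a0.
  have uv_a0b : circ (u ∘ v) =1 circ (a0 ∘ b).
    move=> c; apply: (circ_inj (a := w)); rewrite !circA (circ_inv_lam b a0K).
    by rewrite -circA wb -!circA vK circA -circA a0K.
  apply: circ_eq_of_vdash_eq => c.
  rewrite -(inv_vdashK u c); move: (inv_vdash u c) => d.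
  rewrite (vdashA a u) (vdashA a0 u) vdash_dashv au vdash_lam.
  exact: vdash_eq_of_circ_eq.
have lam_ab : brace_lam a b = u by apply: brace_lam_eq.
exists a; apply: (brace_lam_inj (a := u)).
by rewrite -ua -{1 2}lam_ab brace_lam_rho.
Qed.

End Brace.

Theorem theorem2p11 (D : diSkewBraceType) :
  [/\ solution (@brace_sol D),
      bijective (@brace_sol D),
      nondegenerate (@brace_sol D)
    & forall (hr : left_nondegenerate (@brace_sol D)) (a b : D),
        left_derived_shelf hr a b = conj_op a b].
Proof.
split; [exact: brace_sol_solution | exact: brace_sol_bijective | split | ].
- move=> a; apply: inj_surj_bijective; first exact: brace_lam_inj.
  exact: brace_lam_surj.
- move=> b; apply: inj_surj_bijective; first exact: brace_rho_inj.
  exact: brace_rho_surj.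
move=> hr a b; rewrite /left_derived_shelf.
set c := lam_inv hr b a; have bc : brace_lam b c = a by exact: (lam_invK hr b a).
by rewrite -{1}bc [LHS]brace_lam_rho bc.
Qed.
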